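(* Let $0<\rho'<\rho\le1$, let $y<\frac{y+z}2<m<z$ be real numbers, let $$\beta\in\left(0,\ 2\rho\left(\frac{m-y}{z-y}(z-m)^{\rho-1}-\frac{z-m}{z-y}(m-y)^{\rho-1}\right)\wedge\frac{2m-y-z}{z-m}\right),$$ and, for $\varepsilon>0$, let $$\mu_\varepsilon=\frac{1}{1+(1+\beta\varepsilon^{1-\rho})^{1/\rho}}\,\delta_{m-(1+\beta\varepsilon^{1-\rho})^{1/\rho}\varepsilon}+\frac{(1+\beta\varepsilon^{1-\rho})^{1/\rho}}{1+(1+\beta\varepsilon^{1-\rho})^{1/\rho}}\,\delta_{m+\varepsilon},$$ $$\nu=\frac13\delta_m+\frac{2(z-m)}{3(z-y)}\delta_y+\frac{2(m-y)}{3(z-y)}\delta_z.$$ For $0<\varepsilon<(z-m)\wedge\frac{m-y}{(1+\beta)^{1/\rho}}\wedge\frac{2(z-m)(m-y)}{3(z-y)}\wedge1$, the set $\Pi_M(\mu_\varepsilon,\nu)$ contains distinct martingale couplings and any element of $\Pi_M(\mu_\varepsilon,\nu)$ is non-decreasing. For $\varepsilon>0$ small enough, the non-decreasing martingale coupling in $\Pi_M(\mu_\varepsilon,\nu)$ that attains $\overline{\mathcal M}_{\rho'}(\mu_\varepsilon,\nu)$ is different from the one that attains $\overline{\mathcal M}_\rho(\mu_\varepsilon,\nu)$.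
   Context: $\Pi(\mu,\nu)$ is the set of probability measures on $\mathbb R\times\mathbb R$ with first marginal $\mu$ and second marginal $\nu$; $\Pi_M(\mu,\nu)$ is the set of martingale couplings, i.e. of $\pi(dx,dy)=\mu(dx)\pi_x(dy)\in\Pi(\mu,\nu)$ such that $\int_{\mathbb R} y\,\pi_x(dy)=x$ for $\mu(dx)$-almost every $x$. For $\rho>0$, $\overline{\mathcal M}_\rho$ is defined by $\overline{\mathcal M}_\rho^\rho(\mu,\nu)=\sup_{\pi\in\Pi_M(\mu,\nu)}\int_{\mathbb R\times\mathbb R}|x-y|^\rho\,\pi(dx,dy)$; a coupling attains $\overline{\mathcal M}_\rho(\mu,\nu)$ if it attains this supremum. $a\wedge b=\min(a,b)$. A martingale coupling $\pi\in\Pi_M(\mu,\nu)$ is called non-decreasing if there exists a Borel set $\Gamma\subseteq\mathbb R\times\mathbb R$ such that $\pi(\Gamma)=1$ and: (a) if $(x_-,y_-),(x_+,y_+)\in\Gamma$ with $y_-\le x_-$, $y_+\le x_+$ and $x_-<x_+$, then $y_-\le y_+$; (b) if $(x_-,z_-),(x_+,z_+)\in\Gamma$ with $x_-\le z_-$, $x_+\le z_+$ and $x_-<x_+$, then $z_-\le z_+$. *)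

(* Defs.v *)
From HB Require Import structures.
From mathcomp Require Import all_boot all_order all_algebra.
From mathcomp Require Import all_classical all_reals all_analysis.
From mathcomp Require Import ring lra.
Set Implicit Arguments.
Unset Strict Implicit.
Unset Printing Implicit Defensive.
Import Order.TTheory GRing.Theory Num.Theory numFieldNormedType.Exports.
Local Open Scope classical_set_scope.
Local Open Scope ring_scope.

Section couplings.
Context {R : realType}.
Implicit Types (mu nu : probability R R) (pi : probability (R * R)%type R).

(* A measure of the library is a function on all sets, unconstrained outside
   the sigma-algebra, so measures are compared on measurable sets only. *)
Definition same_measure pi1 pi2 : Prop :=
  forall A : set (R * R), measurable A -> pi1 A = pi2 A.

Definition coupling mu nu : set (probability (R * R)%type R) :=
  [set pi | forall A : set R, measurable A ->
     pushforward pi fst A = mu A /\ pushforward pi snd A = nu A].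

(* The first clause is pi(dx,dy) = mu(dx) k_x(dy). *)
Definition martingale_coupling mu nu : set (probability (R * R)%type R) :=
  [set pi | coupling mu nu pi /\
     exists k : R.-pker R ~> R,
       (forall A : set (R * R), measurable A ->
          pi A = (\int[mu]_x k x (xsection A x))%E) /\
       {ae mu, forall x, (k x).-integrable setT (fun y => y%:E) /\
                         (\int[k x]_y y%:E)%E = x%:E}].

Definition cost (rho : R) pi : \bar R :=
  (\int[pi]_p (`|p.1 - p.2| `^ rho)%:E)%E.

(* The rho-th power of the quantity \overline{M}_rho(mu, nu). *)
Definition maxcost (rho : R) mu nu : \bar R :=
  ereal_sup [set cost rho pi | pi in martingale_coupling mu nu].

Definition attains (rho : R) mu nu pi : Prop :=
  martingale_coupling mu nu pi /\ cost rho pi = maxcost rho mu nu.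

Definition nondecreasing_coupling pi : Prop :=
  exists Gamma : set (R * R),
    [/\ measurable Gamma, pi Gamma = 1%E,
     (forall x1 y1 x2 y2 : R, Gamma (x1, y1) -> Gamma (x2, y2) ->
        y1 <= x1 -> y2 <= x2 -> x1 < x2 -> y1 <= y2) &
     (forall x1 z1 x2 z2 : R, Gamma (x1, z1) -> Gamma (x2, z2) ->
        x1 <= z1 -> x2 <= z2 -> x1 < x2 -> z1 <= z2)].

Definition nondecreasing_attains (rho : R) mu nu pi : Prop :=
  attains rho mu nu pi /\ nondecreasing_coupling pi.

Definition unique_nondecreasing_attains (rho : R) mu nu pi : Prop :=
  nondecreasing_attains rho mu nu pi /\
  forall pi', nondecreasing_attains rho mu nu pi' -> same_measure pi' pi.

End couplings.

Section mu_eps.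
Context {R : realType} (rho beta m eps : R).

Definition ratio : R := (1 + beta * eps `^ (1 - rho)) `^ (1 / rho).

Lemma ratio_ge0 : 0 <= ratio.
Proof. exact: powR_ge0. Qed.

Fact mu_left_ge0 : 0 <= 1 / (1 + ratio).
Proof. by rewrite divr_ge0// addr_ge0// ratio_ge0. Qed.

Fact mu_right_ge0 : 0 <= ratio / (1 + ratio).
Proof. by rewrite divr_ge0 ?addr_ge0// ratio_ge0. Qed.

Definition mu_eps : set R -> \bar R :=
  measure_add (mscale (NngNum mu_left_ge0) \d_(m - ratio * eps)%R)
              (mscale (NngNum mu_right_ge0) \d_(m + eps)%R).

HB.instance Definition _ := Measure.on mu_eps.

Lemma mu_epsE A : mu_eps A =
  ((1 / (1 + ratio))%:E * \d_(m - ratio * eps)%R A +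
   (ratio / (1 + ratio))%:E * \d_(m + eps)%R A)%E.
Proof. exact: measure_addE. Qed.

Fact mu_eps_setT : mu_eps setT = 1%E.
Proof.
rewrite mu_epsE !diracT !mule1 -EFinD; congr _%:E.
by rewrite -mulrDl divff// gt_eqF// ltr_wpDr// ratio_ge0.
Qed.

HB.instance Definition _ :=
  Measure_isProbability.Build _ _ _ mu_eps mu_eps_setT.

End mu_eps.

Section nu_ymz.
Context {R : realType} (y m z : R) (ym : y < m) (mz : m < z).

Fact nu_mid_ge0 : 0 <= 1 / 3 :> R.
Proof. by rewrite divr_ge0. Qed.

Fact nu_left_ge0 : 0 <= 2 * (z - m) / (3 * (z - y)).
Proof.
by rewrite divr_ge0// mulr_ge0// subr_ge0 ltW//; exact: lt_trans mz.
Qed.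

Fact nu_right_ge0 : 0 <= 2 * (m - y) / (3 * (z - y)).
Proof.
by rewrite divr_ge0// mulr_ge0// subr_ge0 ltW//; exact: lt_trans mz.
Qed.

Definition nu_ymz : set R -> \bar R :=
  measure_add (measure_add (mscale (NngNum nu_mid_ge0) \d_m)
                           (mscale (NngNum nu_left_ge0) \d_y))
              (mscale (NngNum nu_right_ge0) \d_z).

HB.instance Definition _ := Measure.on nu_ymz.

Lemma nu_ymzE A : nu_ymz A =
  ((1 / 3)%:E * \d_m A + (2 * (z - m) / (3 * (z - y)))%:E * \d_y A +
   (2 * (m - y) / (3 * (z - y)))%:E * \d_z A)%E.
Proof. by rewrite /nu_ymz measure_addE; congr (_ + _)%E; exact: measure_addE. Qed.

Fact nu_ymz_setT : nu_ymz setT = 1%E.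
Proof.
rewrite nu_ymzE !diracT !mule1 -!EFinD; congr _%:E.
have zy : z - y != 0 by rewrite subr_eq0 gt_eqF// (lt_trans ym mz).
by field.
Qed.

HB.instance Definition _ := Measure_isProbability.Build _ _ _ nu_ymz nu_ymz_setT.

End nu_ymz.

(* Main.v *)
Require Import Defs.
From mathcomp Require Import all_boot all_order all_algebra.
From mathcomp Require Import all_classical all_reals all_analysis.
From mathcomp Require Import measurable_realfun.
From HB Require Import structures.
From mathcomp Require Import ring lra.
Import Order.TTheory GRing.Theory Num.Theory numFieldNormedType.Exports.
Local Open Scope classical_set_scope.
Local Open Scope ring_scope.

(** A law carried by three points y < m < z is determined by its barycentre and
    its mass at m, and its weights are affine in these two numbers.  The
    conditional laws of a martingale coupling of the two-atom measure mu with nu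
    are of this kind, and their barycentres are the atoms a < m < b of mu.  The
    masses that they give to m must average to nu {m}, so one real s, the
    conditional mass at m given a, describes the whole coupling
    ([martingale_coupling_plan], [plan_martingale_coupling]).  Positivity of the
    weights confines s to a compact interval ([feasibleE]), which the bound
    eps < 2 (z - m) (m - y) / (3 (z - y)) keeps from collapsing
    ([mass_interval]).  Every such coupling lives on {a, b} x {y, m, z}; this
    set is itself non-decreasing, because the only target at most a is y and the
    only target at least b is z ([nondecreasing_plan]).

    The cost is affine in s, with slope a positive multiple of D a - D b, where
    D x is what is gained by moving a unit of mass, sent from x, to m from y and
    z in the barycentric proportion ([middle_gain], [plan_cost_affine]).  When
    D a and D b differ, one end of the interval is the unique optimum, and it
    remains to find the sign of D a - D b for the two exponents.

    The ratio r of the masses of b and a is chosen so that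
    (r eps) ^ rho = eps ^ rho + beta eps.  For the exponent rho this contributes
    beta eps to D a - D b, of the same order as the contribution of the far
    points y and z; the upper bound on beta makes the total negative
    ([slope_le], [slope_bound_lt0]).  For rho' < rho the nearby point m
    contributes (r eps) ^ rho' - eps ^ rho', of order
    eps ^ (1 - (rho - rho')), which dominates the linear contribution of the
    far points, so the total is positive ([slope_ge]).  Hence the optimum for
    rho is the smallest s and the optimum for rho' the largest.  The estimates
    rest on one inequality: a power with exponent in (0, 1] lies below its
    tangents ([powR_le_tangent]). *)

Set Implicit Arguments.
Unset Strict Implicit.
Unset Printing Implicit Defensive.

(** * Measures with finitely many atoms *)

Lemma set_seq_cons (T : eqType) (x : T) (s : seq T) :
  [set` x :: s] = [set x] `|` [set` s].
Proof.
apply/seteqP; split=> u /=; rewrite inE.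
  by move=> /orP[/eqP->|us]; [left|right].
by move=> [->|->]; rewrite ?eqxx ?orbT.
Qed.

(** The proof of total mass one is an argument of the definition, so that the
    instance of probability can be inferred from the term. *)
Section total_mass_one.
Context d (T : measurableType d) (R : realType) (M : {measure set T -> \bar R}).
Hypothesis M1 : M setT = 1%E.

Definition to_probability (_ : M setT = 1%E) : set T -> \bar R := fun A => M A.
HB.instance Definition _ := Measure.on (to_probability M1).
HB.instance Definition _ :=
  Measure_isProbability.Build _ _ _ (to_probability M1) M1.
End total_mass_one.

Section discrete_measures.
Context d (T : measurableType d) (R : realType).
Implicit Types (ws : seq (R * T)) (f : T -> \bar R).

(** A plain set function rather than a packed measure, so that weights given by
    formulas need not be known to be non-negative. *)
Definition discrete ws (A : set T) : \bar R :=
  (\sum_(w <- ws) w.1%:E * \d_(w.2) A)%E.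

Definition weights_ge0 ws := all (fun w => 0 <= w.1) ws.

Lemma discrete_measure ws : weights_ge0 ws ->
  exists M : {measure set T -> \bar R},
    (forall A, M A = discrete ws A) /\
    (forall f, measurable_fun setT f -> (forall x, 0 <= f x)%E ->
       (\int[M]_x f x = \sum_(w <- ws) w.1%:E * f w.2)%E).
Proof.
elim: ws => [_|[w x] ws IH /= /andP[w0 /IH[M [ME MI]]]].
  exists mzero; split=> [A|f mf f0]; rewrite ?/discrete big_nil//.
  exact: integral_measure_zero.
exists (measure_add (mscale (NngNum w0) \d_x) M); split=> [A|f mf f0].
  rewrite /discrete big_cons -/(discrete ws A) -ME.
  exact: measure_addE.
rewrite ge0_integral_measure_add// ge0_integral_mscale// integral_dirac//.
by rewrite diracT mul1e MI// big_cons.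
Qed.

Lemma discrete_probability ws : weights_ge0 ws ->
  \sum_(w <- ws) w.1 = 1 ->
  exists P : probability T R, forall A, P A = discrete ws A.
Proof.
move=> w0 w1; have [M [ME _]] := discrete_measure w0.
have M1 : M setT = 1%E.
  rewrite ME /discrete -w1 -sumEFin; apply: eq_bigr => w _.
  by rewrite diracT mule1.
by exists (to_probability M1).
Qed.

(** The hypothesis is restricted to measurable sets, the only ones on which a
    measure is constrained; integrals do not see the others. *)
Lemma ge0_integral_discrete (M : {measure set T -> \bar R}) ws f :
  weights_ge0 ws -> (forall A, measurable A -> M A = discrete ws A) ->
  measurable_fun setT f -> (forall x, 0 <= f x)%E ->
  (\int[M]_x f x = \sum_(w <- ws) w.1%:E * f w.2)%E.
Proof.
move=> w0 ME mf f0; have [N [NE NI]] := discrete_measure w0.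
rewrite -NI//; apply: eq_measure_integral => A mA _.
by rewrite ME// NE.
Qed.

Lemma integral_discrete (M : {measure set T -> \bar R}) ws (g : T -> R) :
  weights_ge0 ws -> (forall A, measurable A -> M A = discrete ws A) ->
  measurable_fun setT g ->
  M.-integrable setT (EFin \o g) /\
  (\int[M]_x (g x)%:E = (\sum_(w <- ws) w.1 * g w.2)%:E)%E.
Proof.
move=> w0 ME mg.
have mf : measurable_fun setT (EFin \o g) by exact/measurable_EFinP.
split.
  apply/integrableP; split=> //.
  rewrite (@ge0_integral_discrete M ws)//; last exact: measurableT_comp.
  have -> : (\sum_(w <- ws) w.1%:E * `|(EFin \o g) w.2| =
            (\sum_(w <- ws) w.1 * `|g w.2|)%:E)%E.
    by rewrite -sumEFin; apply: eq_bigr.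
  by rewrite ltry.
rewrite integralE.
rewrite (@ge0_integral_discrete M ws)//; last exact: measurable_funepos.
rewrite (@ge0_integral_discrete M ws)//; last exact: measurable_funeneg.
have -> : (\sum_(w <- ws) w.1%:E * ((EFin \o g)^\+ w.2) =
            (\sum_(w <- ws) w.1 * Num.max (g w.2) 0)%:E)%E.
  by rewrite -sumEFin; apply: eq_bigr => w _; rewrite funeposE EFinM EFin_max.
have -> : (\sum_(w <- ws) w.1%:E * ((EFin \o g)^\- w.2) =
            (\sum_(w <- ws) w.1 * Num.max (- g w.2) 0)%:E)%E.
  by rewrite -sumEFin; apply: eq_bigr => w _; rewrite funenegE EFinM EFin_max.
rewrite -EFinB -sumrB; congr EFin; apply: eq_bigr => w _.
rewrite -mulrBr; congr (_ * _).
by case: (leP (g w.2) 0) => ?; case: (leP (- g w.2) 0) => ?; lra.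
Qed.

(** This is how an unknown measure, such as a disintegration kernel, is turned
    into finitely many real unknowns. *)
Lemma discrete_of_support (P : probability T R) (xs : seq T) : uniq xs ->
  (forall x : T, measurable [set x]) -> P (~` [set` xs]) = 0%E ->
  forall A, measurable A ->
    P A = discrete [seq (fine (P [set x]), x) | x <- xs] A.
Proof.
move=> uxs m1 P0 A mA.
have mxs s : measurable [set` s : seq T].
  elim: s => [|x s IH]; first by rewrite classical_sets.set_nil.
  by rewrite set_seq_cons; apply: measurableU.
have PAs s : uniq s ->
    P (A `&` [set` s]) = discrete [seq (fine (P [set x]), x) | x <- s] A.
  elim: s => [_|x s IH /= /andP[xNs us]].
    by rewrite classical_sets.set_nil setI0 measure0 /discrete big_nil.
  rewrite set_seq_cons setIUr measureU//; last 3 first.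
  - exact: measurableI.
  - exact: measurableI.
  - by apply/seteqP; split=> // u [[_ ->] [_ /=]]; rewrite (negbTE xNs).
  rewrite /discrete big_cons; congr (_ + _)%E; last exact: IH.
  rewrite /= fineK; last exact: fin_num_measure.
  rewrite diracE; case: (boolP (x \in A)) => [/set_mem Ax|/negP Ax] /=.
    rewrite mule1; congr (P _); apply/seteqP; split=> u /=; first by case.
    by move=> ->.
  rewrite mule0 (_ : _ `&` _ = set0) ?measure0//.
  by apply/seteqP; split=> // u [Au ux]; apply: Ax; rewrite inE -ux.
rewrite (measureDI _ mA (mxs xs)) setDE -PAs// -[RHS]add0e; congr (_ + _)%E.
apply: subset_measure0 P0 => //; last exact: measurableC.
by apply: measurableI => //; exact: measurableC.
Qed.

End discrete_measures.

Lemma discreteE d (T : measurableType d) (R : realType) (ws : seq (R * T)) A :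
  discrete ws A = (\sum_(w <- ws) w.1 * \1_A w.2)%:E.
Proof. by rewrite /discrete -sumEFin; apply: eq_bigr => w _; rewrite diracE. Qed.

(** * Laws on three points *)

Section three_point_laws.
Context {R : realType} (y m z : R).
Hypotheses (ym : y < m) (mz : m < z).

(** The masses at y and z forced by the barycentre x and the mass s at m: they
    solve the two linear equations given by total mass and mean. *)
Definition left_weight (x s : R) : R := (z - x - s * (z - m)) / (z - y).
Definition right_weight (x s : R) : R := (x - y - s * (m - y)) / (z - y).

Definition law (x s : R) : seq (R * R) :=
  [:: (left_weight x s, y); (s, m); (right_weight x s, z)].

Definition admissible (x s : R) : bool :=
  [&& 0 <= s, s * (z - m) <= z - x & s * (m - y) <= x - y].

Let zy_neq0 : z - y != 0.
Proof. by rewrite subr_eq0 gt_eqF// (lt_trans ym). Qed.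

Let zy_gt0 : 0 < z - y.
Proof. by rewrite subr_gt0 (lt_trans ym). Qed.

Lemma weights_ge0_law (x s : R) : admissible x s = weights_ge0 (law x s).
Proof.
rewrite /admissible /weights_ge0 /= andbT /left_weight /right_weight.
by rewrite !pmulr_lge0 ?invr_gt0 // !subr_ge0 andbCA.
Qed.

Lemma law_mass (x s : R) : \sum_(w <- law x s) w.1 = 1.
Proof.
by rewrite !big_cons big_nil /= /left_weight /right_weight; field.
Qed.

Lemma law_mean (x s : R) : \sum_(w <- law x s) w.1 * w.2 = x.
Proof.
by rewrite !big_cons big_nil /= /left_weight /right_weight; field.
Qed.

(** Barycentre and middle mass are affine coordinates on these laws. *)
Lemma law_mix (p q x x' s s' : R) A : p + q = 1 ->
  (p%:E * discrete (law x s) A + q%:E * discrete (law x' s') A)%E =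
  discrete (law (p * x + q * x') (p * s + q * s')) A.
Proof.
move=> pq; have -> : q = 1 - p by rewrite -pq addrC addKr.
rewrite !discreteE -!EFinM -EFinD; congr EFin.
by rewrite !big_cons !big_nil /= /left_weight /right_weight; field.
Qed.

Lemma law_of_mean (K : probability R R) (x : R) :
  K (~` [set` [:: y; m; z]]) = 0%E -> (\int[K]_u u%:E)%E = x%:E ->
  let s := fine (K [set m]) in
  admissible x s /\ forall A, measurable A -> K A = discrete (law x s) A.
Proof.
move=> K0 Kx s.
have KE := @discrete_of_support _ _ _ K [:: y; m; z] _ (@measurable_set1 R) K0.
have /KE{}KE : uniq [:: y; m; z].
  by rewrite /= !inE negb_or !lt_eqF// (lt_trans ym).
pose al := fine (K [set y]); pose ga := fine (K [set z]).
have w0 : weights_ge0 [:: (al, y); (s, m); (ga, z)].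
  by rewrite /= !fine_ge0.
have mass : al + s + ga = 1.
  have := KE _ measurableT; rewrite probability_setT /discrete !big_cons big_nil.
  by rewrite /= !diracT !mule1 adde0 -!EFinD => -[->]; rewrite addrA.
have mean : al * y + s * m + ga * z = x.
  have := (integral_discrete w0 KE (@measurable_id _ _ setT)).2.
  by rewrite Kx !big_cons big_nil /= => -[->]; rewrite addr0 addrA.
have lawE : law x s = [:: (al, y); (s, m); (ga, z)].
  rewrite /law /left_weight /right_weight -mean.
  have -> : al = 1 - s - ga by rewrite -mass; ring.
  by congr [:: (_, _); _; (_, _)]; field.
by rewrite weights_ge0_law lawE; split.
Qed.

End three_point_laws.

(** * Martingale couplings of a two-atom measure with a three-point law *)

Lemma discrete_slice (R : realType) (p a : R) (ws : seq (R * R)) A :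
  discrete [seq (p * w.1, (a, w.2)) | w <- ws] A =
  (p%:E * discrete ws (xsection A a))%E.
Proof.
rewrite !discreteE -EFinM big_map mulr_sumr; congr EFin; apply: eq_bigr => w _.
by rewrite /= !indicE mem_xsection mulrA.
Qed.

Lemma measurable_pair1 (R : realType) (u : R * R) : measurable [set u].
Proof.
case: u => x1 x2; rewrite (_ : [set _] = [set x1] `*` [set x2]).
  exact: measurableX.
by apply/seteqP; split=> -[u v] /= [-> ->].
Qed.

Section two_valued_kernel.
Context {R : realType} (a : R) (Ka Kb : probability R R).

(** A kernel only matters at the two atoms of the first marginal, so any value
    away from a and b will do. *)
Definition two_laws (x : R) : {measure set R -> \bar R} :=
  if x == a then Ka : {measure set R -> \bar R} else Kb.

Let measurable_two_laws U : measurable U ->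
  measurable_fun [set: R] (two_laws ^~ U).
Proof.
move=> mU; rewrite (_ : two_laws ^~ U = fun x => if x == a then Ka U else Kb U).
  apply: measurable_fun_ifT => //.
  apply: (measurable_fun_bool true) => /=.
  rewrite setTI (_ : _ @^-1` _ = [set a]); first exact: measurable_set1.
  by apply/seteqP; split=> x /= /eqP.
by apply/funext => x; rewrite /two_laws; case: ifP.
Qed.

HB.instance Definition _ :=
  isKernel.Build _ _ _ _ R two_laws measurable_two_laws.

Let two_laws_setT x : two_laws x setT = 1%E.
Proof. by rewrite /two_laws; case: ifP => _; exact: probability_setT. Qed.

HB.instance Definition _ :=
  Kernel_isProbability.Build _ _ _ _ R two_laws two_laws_setT.
End two_valued_kernel.

Section two_atoms_to_three.
Context {R : realType} (y m z a b p q n : R) (mu nu : probability R R).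
Hypotheses (ym : y < m) (mz : m < z) (ab : a < b).
Hypotheses (p_gt0 : 0 < p) (q_gt0 : 0 < q) (mean : p * a + q * b = m).
Hypothesis mass : p + q = 1.
Hypothesis muE :
  forall A, measurable A -> mu A = discrete [:: (p, a); (q, b)] A.
Hypothesis nuE : forall A, measurable A -> nu A = discrete (law y m z m n) A.

(** The conditional mass at m given b, when the one given a is s: the two must
    average to the mass n that nu gives to m. *)
Definition other_mass (s : R) : R := (n - p * s) / q.

Definition feasible (s : R) : bool :=
  admissible y m z a s && admissible y m z b (other_mass s).

Definition plan (s : R) : seq (R * (R * R)) :=
  [seq (p * w.1, (a, w.2)) | w <- law y m z a s] ++
  [seq (q * w.1, (b, w.2)) | w <- law y m z b (other_mass s)].

Let pq_ge0 : weights_ge0 [:: (p, a); (q, b)].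
Proof. by rewrite /= !ltW. Qed.

Lemma discrete_plan s A : discrete (plan s) A =
  (p%:E * discrete (law y m z a s) (xsection A a) +
   q%:E * discrete (law y m z b (other_mass s)) (xsection A b))%E.
Proof. by rewrite -!discrete_slice /discrete big_cat. Qed.

Lemma weights_ge0_plan s : feasible s -> weights_ge0 (plan s).
Proof.
rewrite /feasible !(weights_ge0_law ym mz) => /andP[sa sb].
rewrite /weights_ge0 all_cat !all_map; apply/andP; split.
  by apply: sub_all sa => w /= w0; rewrite mulr_ge0// ltW.
by apply: sub_all sb => w /= w0; rewrite mulr_ge0// ltW.
Qed.

Lemma integral_two_atoms (f : R -> \bar R) :
  measurable_fun setT f -> (forall x, 0 <= f x)%E ->
  (\int[mu]_x f x = p%:E * f a + q%:E * f b)%E.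
Proof.
move=> mf f0; rewrite (ge0_integral_discrete pq_ge0 muE)//.
by rewrite !big_cons big_nil adde0.
Qed.

Lemma ae_two_atoms (P : set R) : {ae mu, forall x, P x} -> P a /\ P b.
Proof.
move=> [N [mN muN PN]].
have : (p%:E * \d_a N + q%:E * \d_b N)%E = 0%E.
  by rewrite -muN muE// /discrete !big_cons big_nil adde0.
rewrite !diracE -!EFinM -EFinD => -[] /eqP.
rewrite paddr_eq0; [|by rewrite mulr_ge0// ltW..].
rewrite !mulf_eq0 (gt_eqF p_gt0) (gt_eqF q_gt0) !orFb !pnatr_eq0 !eqb0.
move=> /andP[/negP aN /negP bN].
by split; apply: contrapT => ?; [apply: aN|apply: bN];
  rewrite inE; apply: PN.
Qed.

(** The kernel is pinned down at a and b only, which are atoms of mu: there its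
    mean is prescribed, and it does not charge the complement of {y, m, z}
    because nu does not.  So its two values are three-point laws, and the mass
    of nu at m relates their middle masses. *)
Lemma martingale_coupling_plan pi : martingale_coupling mu nu pi ->
  exists2 s, feasible s & forall A, measurable A -> pi A = discrete (plan s) A.
Proof.
move=> [cpl [k [kE kmean]]]; have [[_ ka] [_ kb]] := ae_two_atoms kmean.
have piE A : measurable A ->
    (pi A = p%:E * k a (xsection A a) + q%:E * k b (xsection A b))%E.
  move=> mA; rewrite kE// integral_two_atoms//.
  by apply: measurable_fun_xsection_finite_kernel; rewrite inE.
have nuk A : measurable A -> (nu A = p%:E * k a A + q%:E * k b A)%E.
  move=> mA; rewrite -(cpl A mA).2 /pushforward piE; last first.
    by rewrite -[X in measurable X]setTI; exact: measurable_snd.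
  by congr (_ * k a _ + _ * k b _)%E; apply/seteqP; split=> x;
    rewrite /xsection/= inE.
have mS : measurable (~` [set` [:: y; m; z]]).
  apply: measurableC; rewrite !set_seq_cons classical_sets.set_nil setU0.
  by apply: measurableU => //; apply: measurableU.
have : nu (~` [set` [:: y; m; z]]) = 0%E.
  rewrite nuE// /discrete !big_cons big_nil !diracE !memNset ?mule0 ?adde0//=;
    by rewrite !inE eqxx ?orbT.
rewrite nuk// => /eqP.
rewrite padde_eq0; [|by rewrite mule_ge0// lee_fin ltW..].
rewrite !mule_eq0 !eqe (gt_eqF p_gt0) (gt_eqF q_gt0) !orFb.
move=> /andP[/eqP ka0 /eqP kb0].
have klaw x : k x (~` [set` [:: y; m; z]]) = 0%E ->
    (\int[k x]_u u%:E)%E = x%:E ->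
    admissible y m z x (fine (k x [set m])) /\
    forall A, measurable A ->
      k x A = discrete (law y m z x (fine (k x [set m]))) A.
  exact: (law_of_mean ym mz (K := to_probability (prob_kernel x))).
have [sa kaE] := klaw a ka0 ka; have [sb kbE] := klaw b kb0 kb.
have sbE : fine (k b [set m]) = other_mass (fine (k a [set m])).
  have := nuk _ (measurable_set1 m).
  have kfin x : k x [set m] \is a fin_num.
    exact: (fin_num_measure (to_probability (prob_kernel x))).
  rewrite nuE// -(fineK (kfin a)) -(fineK (kfin b)).
  rewrite discreteE !big_cons big_nil /= !indicE !classical_sets.in_set1 eqxx.
  rewrite (lt_eqF ym) (gt_eqF mz) -EFinM -EFinM -EFinD => -[].
  rewrite /other_mass !mulr0 mulr1 add0r !addr0 => ->.
  by rewrite addrAC subrr add0r mulrAC divff ?mul1r// gt_eqF.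
exists (fine (k a [set m])).
  by apply/andP; split; [exact: sa|rewrite -sbE; exact: sb].
move=> A mA; rewrite (piE _ mA) discrete_plan -sbE.
rewrite (kaE _ (measurable_xsection a mA)).
by rewrite (kbE _ (measurable_xsection b mA)).
Qed.

Let law_probability x s : admissible y m z x s ->
  exists K : probability R R, [/\ forall A, K A = discrete (law y m z x s) A,
    K.-integrable setT (fun u => u%:E) & (\int[K]_u u%:E)%E = x%:E].
Proof.
rewrite (weights_ge0_law ym mz) => w0.
have [K KE] := discrete_probability w0 (law_mass ym mz x s).
have [Ki Km] := integral_discrete w0 (fun A _ => KE A) (@measurable_id _ _ setT).
by exists K; split=> //; rewrite Km law_mean.
Qed.

Lemma plan_mass s : \sum_(w <- plan s) w.1 = 1.
Proof. by rewrite big_cat !big_map /= -!mulr_sumr !law_mass// !mulr1. Qed.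

(** The second marginal is right because three-point laws mix affinely: the
    mixture of the two conditional laws has barycentre p a + q b = m and middle
    mass n, like nu. *)
Lemma plan_martingale_coupling s : feasible s ->
  exists2 pi, martingale_coupling mu nu pi &
              forall A, pi A = discrete (plan s) A.
Proof.
move=> fs; have /andP[sa sb] := fs.
have [Ka [KaE Kai Kam]] := law_probability sa.
have [Kb [KbE Kbi Kbm]] := law_probability sb.
have [pi piE] := discrete_probability (weights_ge0_plan fs) (plan_mass s).
have piK A : (pi A = p%:E * Ka (xsection A a) + q%:E * Kb (xsection A b))%E.
  by rewrite piE discrete_plan KaE KbE.
have ba : (b == a) = false by rewrite gt_eqF.
exists pi => //; split.
  move=> A mA; split; rewrite /pushforward piK.
    have slice x (K : probability R R) :
        K (xsection (fst @^-1` A) x) = \d_x A.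
      rewrite diracE; case: (boolP (x \in A)) => xA /=.
        rewrite (_ : xsection _ _ = setT) ?probability_setT//.
        by apply/seteqP; split=> // u _; rewrite /xsection/= inE.
      rewrite (_ : xsection _ _ = set0) ?measure0//.
      apply/seteqP; split=> // u; rewrite /xsection/= inE => xA'.
      by case/negP: xA; exact: mem_set.
    by rewrite !slice// muE// /discrete !big_cons big_nil adde0.
  rewrite (_ : xsection _ a = A); last first.
    by apply/seteqP; split=> u; rewrite /xsection/= inE.
  rewrite (_ : xsection _ b = A); last first.
    by apply/seteqP; split=> u; rewrite /xsection/= inE.
  rewrite KaE KbE (law_mix ym mz)// mean nuE// /other_mass mulrC.
  by rewrite mulrCA divff ?mulr1 ?gt_eqF// addrC subrK.
exists (two_laws a Ka Kb); split.
  move=> A mA; rewrite integral_two_atoms//; last first.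
    by apply: measurable_fun_xsection_finite_kernel; rewrite inE.
  by rewrite piK /= /two_laws eqxx ba.
have mS : measurable (~` [set a; b]) by apply: measurableC; apply: measurableU.
exists (~` [set a; b]); split=> //.
- rewrite muE// /discrete !big_cons big_nil !diracE !memNset ?mule0 ?adde0//=.
    by apply; right.
  by apply; left.
- move=> x /= nx [|] xE; apply: nx; rewrite xE /two_laws.
    by rewrite eqxx.
  by rewrite ba.
Qed.

Definition plan_cost (rho s : R) : R :=
  \sum_(w <- plan s) w.1 * `|w.2.1 - w.2.2| `^ rho.

Lemma cost_plan rho s (pi : probability (R * R)%type R) : feasible s ->
  (forall A, measurable A -> pi A = discrete (plan s) A) ->
  cost rho pi = (plan_cost rho s)%:E.
Proof.
move=> fs piE; rewrite /cost (ge0_integral_discrete (weights_ge0_plan fs) piE).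
- by rewrite /plan_cost -sumEFin.
- apply/measurable_EFinP.
  have md : measurable_fun setT (fun u : R * R => `|u.1 - u.2|).
    apply: measurableT_comp => //.
    by apply: measurable_funB; [exact: measurable_fst|exact: measurable_snd].
  exact: (measurableT_comp (@measurable_powR R rho) md).
- by move=> u; rewrite lee_fin powR_ge0.
Qed.

(** The derivative, in the middle mass, of the cost of the law with barycentre x:
    a unit of mass put at m is taken from y and z in the proportions that keep
    the mean. *)
Definition middle_gain (rho x : R) : R :=
  `|x - m| `^ rho -
  ((z - m) * `|x - y| `^ rho + (m - y) * `|x - z| `^ rho) / (z - y).

(** Raising s by a unit moves the mass p to m in the row of a, and removes the same
    mass from m in the row of b. *)
Lemma plan_cost_affine rho s t : plan_cost rho t =
  plan_cost rho s + (t - s) * (p * (middle_gain rho a - middle_gain rho b)).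
Proof.
have zy_neq0 : z - y != 0 by rewrite subr_eq0 gt_eqF// (lt_trans ym).
have q_neq0 : q != 0 by rewrite gt_eqF.
rewrite /plan_cost /plan /law /left_weight /right_weight /other_mass.
rewrite /middle_gain !big_cons !big_nil /=.
by field; rewrite zy_neq0 q_neq0.
Qed.

Lemma plan_middle s : discrete (plan s) [set (a, m)] = (p * s)%:E.
Proof.
rewrite discreteE !big_cons big_nil /= !indicE !classical_sets.in_set1.
rewrite !xpair_eqE !eqxx (gt_eqF ab) (lt_eqF ym) (gt_eqF mz) /=.
by congr EFin; ring.
Qed.

Lemma plan_same s t (pi1 pi2 : probability (R * R)%type R) :
  (forall A, measurable A -> pi1 A = discrete (plan s) A) ->
  (forall A, measurable A -> pi2 A = discrete (plan t) A) ->
  same_measure pi1 pi2 <-> s = t.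
Proof.
move=> E1 E2; split=> [E|st A mA]; last by rewrite E1// E2// st.
have mS := measurable_pair1 (a, m).
have := E _ mS; rewrite E1// E2// !plan_middle => -[].
by apply: mulfI; rewrite gt_eqF.
Qed.

(** In both monotonicity conditions the left point starts from a and the right
    one from b; the left target is then y in the first, and the right target z
    in the second. *)
Lemma nondecreasing_plan s (pi : probability (R * R)%type R) :
  y <= a -> a < m -> m < b -> b <= z ->
  (forall A, measurable A -> pi A = discrete (plan s) A) ->
  nondecreasing_coupling pi.
Proof.
move=> ya am mb bz piE.
exists ([set a; b] `*` [set` [:: y; m; z]]).
have mG : measurable ([set a; b] `*` [set` [:: y; m; z]]).
  apply: measurableX; first exact: measurableU.
  rewrite !set_seq_cons classical_sets.set_nil setU0.
  by apply: measurableU => //; apply: measurableU.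
have cases u : u \in [:: y; m; z] -> [\/ u = y, u = m | u = z].
  by rewrite !inE => /or3P[] /eqP; [constructor 1|constructor 2|constructor 3].
have atoms_lt x1 x2 : x1 = a \/ x1 = b -> x2 = a \/ x2 = b -> x1 < x2 ->
    x1 = a /\ x2 = b.
  by move=> [->|->] [->|->] //; rewrite ?ltxx// => /(lt_trans ab); rewrite ltxx.
split=> //.
- rewrite piE// discreteE -(plan_mass s); congr EFin.
  apply: eq_big_seq => w; rewrite mem_cat => /orP[] /mapP[v vl ->] /=;
    rewrite indicE mem_set ?mulr1//; (split; [by [left|right]|]) => /=;
    by move: vl; rewrite !inE => /or3P[] /eqP->; rewrite eqxx ?orbT.
- move=> x1 y1 x2 y2 /= [x1E /cases y1E] [x2E /cases y2E] y1x _ /atoms_lt.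
  move=> /(_ x1E x2E)[x1a _]; move: y1E y1x; rewrite x1a => -[] -> ?; [|lra..].
  by case: y2E => ->; lra.
- move=> x1 z1 x2 z2 /= [x1E /cases z1E] [x2E /cases z2E] _ z2x /atoms_lt.
  move=> /(_ x1E x2E)[_ x2b]; move: z2E z2x; rewrite x2b => -[] -> ?; [lra..|].
  by case: z1E => ->; lra.
Qed.

Lemma unique_optimum rho s0 :
  y < a -> a < m -> m < b -> b < z -> feasible s0 ->
  (forall s, feasible s -> s != s0 -> plan_cost rho s < plan_cost rho s0) ->
  exists2 pi, unique_nondecreasing_attains rho mu nu pi &
              forall A, pi A = discrete (plan s0) A.
Proof.
move=> ya am mb bz f0 opt.
have [pi piM piE] := plan_martingale_coupling f0.
have pi_cost := cost_plan rho f0 (fun A _ => piE A).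
have pi_max : cost rho pi = maxcost rho mu nu.
  apply/eqP; rewrite eq_le; apply/andP; split.
    by apply: ereal_sup_ubound; exists pi.
  apply: ge_ereal_sup => _ [pi' /martingale_coupling_plan[s fs pi'E] <-].
  rewrite pi_cost (cost_plan rho fs pi'E) lee_fin.
  by case: (eqVneq s s0) => [->//|ss0]; exact/ltW/opt.
exists pi => //; split.
  by split=> //; apply: (@nondecreasing_plan s0) => //; exact: ltW.
move=> pi' [[/martingale_coupling_plan[s fs pi'E] pi'_max] _].
apply/(plan_same pi'E (fun A _ => piE A)).
move: pi'_max; rewrite -pi_max pi_cost (cost_plan rho fs pi'E) => -[cs].
by apply/eqP/negPn/negP => /(opt _ fs); rewrite cs ltxx.
Qed.

(** The ends of the range of s.  For x < m the mass at y is positive as soon as the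
    mass at z is non-negative, and symmetrically for x > m; so the binding
    constraints are s >= 0 and the weight of z in the row of a, and the same for
    [other_mass s] and the weight of y in the row of b. *)
Definition mass_min : R := Num.max 0 ((n - q * ((z - b) / (z - m))) / p).
Definition mass_max : R := Num.min ((a - y) / (m - y)) (n / p).

Lemma feasibleE s : a < m -> m < b -> feasible s = (mass_min <= s <= mass_max).
Proof.
move=> am mb.
have my : 0 < m - y by rewrite subr_gt0.
have zm : 0 < z - m by rewrite subr_gt0.
rewrite /mass_min /mass_max ge_max le_min !ler_pdivlMr// ler_pdivrMr//.
have -> : (n - q * ((z - b) / (z - m)) <= s * p) =
          (other_mass s * (z - m) <= z - b).
  rewrite -[RHS]ler_pdivlMr// /other_mass ler_pdivrMr// [s * p]mulrC.
  by rewrite lerBlDr [RHS]lerBlDl [q * _]mulrC.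
have -> : (s * p <= n) = (0 <= other_mass s).
  by rewrite /other_mass pmulr_lge0 ?invr_gt0// subr_ge0 mulrC.
rewrite /feasible /admissible; apply/idP/idP.
  by move=> /andP[/and3P[-> _ ->] /and3P[-> -> _]].
move=> /andP[/andP[s0 tz] /andP[sy t0]]; rewrite s0 sy t0 tz /= andbT.
have s1 : s <= 1 by rewrite -(ler_pM2r my) mul1r; lra.
have t1 : other_mass s <= 1 by rewrite -(ler_pM2r zm) mul1r; lra.
have := ler_wpM2r (ltW zm) s1; have := ler_wpM2r (ltW my) t1.
by rewrite !mul1r => ? ?; apply/andP; split; lra.
Qed.

Lemma mass_min_lt_max : y < a -> b < z -> 0 < n ->
  n < p * ((a - y) / (m - y)) + q * ((z - b) / (z - m)) -> mass_min < mass_max.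
Proof.
move=> ya bz n0 nlt.
have my : 0 < m - y by rewrite subr_gt0.
have zm : 0 < z - m by rewrite subr_gt0.
have zb : 0 < q * ((z - b) / (z - m)) by rewrite mulr_gt0// divr_gt0// subr_gt0.
rewrite /mass_min /mass_max gt_max !lt_min !divr_gt0 ?subr_gt0//=.
rewrite ltr_pM2r ?invr_gt0// ltr_pdivrMr// mulrC.
by apply/andP; split; lra.
Qed.

Lemma distinct_martingale_couplings : y < a -> a < m -> m < b -> b < z ->
  mass_min < mass_max ->
  exists pi1 pi2, [/\ martingale_coupling mu nu pi1,
    martingale_coupling mu nu pi2 & ~ same_measure pi1 pi2].
Proof.
move=> ya am mb bz lt_mass.
have fmin : feasible mass_min by rewrite feasibleE// lexx ltW.
have fmax : feasible mass_max by rewrite feasibleE// lexx ltW.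
have [pi1 M1 E1] := plan_martingale_coupling fmin.
have [pi2 M2 E2] := plan_martingale_coupling fmax.
exists pi1, pi2; split=> // /(plan_same (fun A _ => E1 A) (fun A _ => E2 A)) E.
by move: lt_mass; rewrite E ltxx.
Qed.

Lemma distinct_optima rho1 rho2 : y < a -> a < m -> m < b -> b < z ->
  mass_min < mass_max ->
  middle_gain rho1 b < middle_gain rho1 a ->
  middle_gain rho2 a < middle_gain rho2 b ->
  exists pi1 pi2, [/\ unique_nondecreasing_attains rho1 mu nu pi1,
    unique_nondecreasing_attains rho2 mu nu pi2 & ~ same_measure pi1 pi2].
Proof.
move=> ya am mb bz lt_mass gain1 gain2.
have fmin : feasible mass_min by rewrite feasibleE// lexx ltW.
have fmax : feasible mass_max by rewrite feasibleE// lexx ltW.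
have opt1 s : feasible s -> s != mass_max ->
    plan_cost rho1 s < plan_cost rho1 mass_max.
  rewrite feasibleE// => /andP[_ s_le] s_neq.
  rewrite (plan_cost_affine rho1 mass_max s) gtrDl pmulr_llt0.
    by rewrite subr_lt0 lt_neqAle s_neq.
  by rewrite mulr_gt0// subr_gt0.
have opt2 s : feasible s -> s != mass_min ->
    plan_cost rho2 s < plan_cost rho2 mass_min.
  rewrite feasibleE// => /andP[s_ge _] s_neq.
  rewrite (plan_cost_affine rho2 mass_min s) gtrDl pmulr_rlt0.
    by rewrite pmulr_rlt0// subr_lt0.
  by rewrite subr_gt0 lt_neqAle eq_sym s_neq.
have [pi1 O1 E1] := unique_optimum ya am mb bz fmax opt1.
have [pi2 O2 E2] := unique_optimum ya am mb bz fmin opt2.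
exists pi1, pi2; split=> // /(plan_same (fun A _ => E1 A) (fun A _ => E2 A)) E.
by move: lt_mass; rewrite E ltxx.
Qed.

End two_atoms_to_three.

(** * Powers with real exponent *)

Section powers.
Context {R : realType}.
Implicit Types (s u v : R).

(** Young's inequality with exponents 1 / s and 1 / (1 - s) bounds
    u ^ s * v ^ (1 - s) by s u + (1 - s) v; dividing by v ^ (1 - s) gives the
    tangent of the concave function u ^ s at v. *)
Lemma powR_le_tangent s u v : 0 < s -> s <= 1 -> 0 < u -> 0 < v ->
  u `^ s <= v `^ s + s * v `^ (s - 1) * (u - v).
Proof.
move=> s0; rewrite le_eqVlt => /predU1P[->|s1] u0 v0.
  by rewrite subrr powRr0 (powRr1 (ltW u0)) (powRr1 (ltW v0)); lra.
have s'0 : 0 < 1 - s by rewrite subr_gt0.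
have := @conjugate_powR R (u `^ s) (v `^ (1 - s)) s^-1 (1 - s)^-1
  (powR_ge0 _ _) (powR_ge0 _ _).
rewrite !invr_gt0 !invrK subrKC -!powRrM !divff ?gt_eqF//.
rewrite (powRr1 (ltW u0)) (powRr1 (ltW v0)) => /(_ s0 s'0 erefl) young.
have vs : v `^ (s - 1) * v `^ (1 - s) = 1.
  rewrite -powRD; last by rewrite (gt_eqF v0) implybT.
  by rewrite addrA subrK subrr powRr0.
have vs1 : v * v `^ (s - 1) = v `^ s by exact: mulr_powRB1 (ltW v0) s0.
have := ler_wpM2l (powR_ge0 v (s - 1)) young.
rewrite mulrCA vs mulr1 => /le_trans; apply; rewrite -vs1.
by rewrite le_eqVlt; apply/orP; left; apply/eqP; ring.
Qed.

Lemma powR_le_anti s u v : s <= 0 -> 0 < u -> u <= v -> v `^ s <= u `^ s.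
Proof.
move=> s0 u0 uv; have v0 := lt_le_trans u0 uv.
rewrite -[s]opprK !(powRN _ (- s)) lef_pV2 ?posrE ?powR_gt0//.
by apply: ge0_ler_powR; rewrite ?oppr_ge0// nnegrE ltW.
Qed.

Lemma cvg_powR (T : Type) (F : set_system T) {FF : Filter F} (f : T -> R) s v :
  0 < v -> f @ F --> v -> (f x `^ s) @[x --> F] --> v `^ s.
Proof.
move=> v0 fv.
suff cv : {for v, continuous (fun x => x `^ s)} by exact: (continuous_cvg _ cv fv).
have := @is_derive1_powR R s v v0 => /@ex_derive /derivable1_diffP.
exact: differentiable_continuous.
Qed.

End powers.

(** * The ratio of the two masses of the first marginal *)

Section mass_ratio.
Context {R : realType} (rho beta : R).
Hypotheses (rho_gt0 : 0 < rho) (rho_le1 : rho <= 1) (beta_gt0 : 0 < beta).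

Lemma powR_ratio s eps : Defs.ratio rho beta eps `^ s =
  (1 + beta * eps `^ (1 - rho)) `^ (s / rho).
Proof. by rewrite /Defs.ratio -powRrM div1r [rho^-1 * s]mulrC. Qed.

Lemma ratio_gt0 eps : 0 < Defs.ratio rho beta eps.
Proof. by rewrite powR_gt0// ltr_wpDr// mulr_ge0// ?powR_ge0// ltW. Qed.

Lemma ratio_le eps : 0 < eps -> eps < 1 ->
  Defs.ratio rho beta eps <= (1 + beta) `^ (1 / rho).
Proof.
move=> e0 e1; apply: ge0_ler_powR; rewrite ?nnegrE.
- by rewrite divr_ge0// ltW.
- by rewrite addr_ge0// mulr_ge0 ?powR_ge0// ltW.
- by rewrite addr_ge0// ltW.
rewrite lerD2l -[leRHS]mulr1 ler_pM2l//.
rewrite -[leRHS](powRr0 eps); apply: ger_powR; first by rewrite e0 ltW.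
by rewrite subr_ge0.
Qed.

(** The property for which the ratio is designed. *)
Lemma ratio_powR_increment eps : 0 < eps ->
  (Defs.ratio rho beta eps * eps) `^ rho = eps `^ rho + beta * eps.
Proof.
move=> e0; rewrite powRM ?ltW ?ratio_gt0// powR_ratio divff ?gt_eqF//.
rewrite powRr1; last by rewrite addr_ge0// mulr_ge0 ?powR_ge0// ltW.
rewrite mulrDl mul1r -mulrA -powRD; last by rewrite (gt_eqF e0) implybT.
by rewrite subrK powRr1// ltW.
Qed.

(** The correction beta eps ^ (1 - rho) vanishes in the limit, except for rho = 1
    where it is the constant beta.  This is why beta has two upper bounds. *)
Lemma cvg_ratio : exists r0 : R,
  Defs.ratio rho beta eps @[eps --> 0^'+] --> r0 /\
  ((rho < 1 /\ r0 = 1) \/ (rho = 1 /\ r0 = 1 + beta)).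
Proof.
move: rho_le1; rewrite le_eqVlt => /predU1P[rho1|rho_lt1].
  exists (1 + beta); split; last by right.
  rewrite (_ : Defs.ratio rho beta = fun=> 1 + beta); first exact: cvg_cst.
  apply/funext => eps; rewrite /Defs.ratio rho1 subrr powRr0 mulr1 divr1 powRr1//.
  by rewrite addr_ge0// ltW.
exists 1; split; last by left.
have one : (1 : R) `^ (1 / rho) = 1 by rewrite powR1.
rewrite -[X in _ --> X]one.
apply: cvg_powR => //; rewrite -[X in _ --> X]addr0.
apply: cvgD; first exact: cvg_cst.
rewrite -[X in _ --> X](mulr0 beta); apply: cvgM; first exact: cvg_cst.
by apply: powR_cvg0; rewrite subr_gt0.
Qed.

End mass_ratio.

(** * Sign of the slope of the cost *)

Section slopes.
Context {R : realType} (rho beta Y Z : R).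
Hypotheses (rho_gt0 : 0 < rho) (rho_le1 : rho <= 1) (beta_gt0 : 0 < beta).
Hypotheses (Y_gt0 : 0 < Y) (Z_gt0 : 0 < Z).
Local Notation r := (Defs.ratio rho beta).

(** The difference of [middle_gain] between the atoms m - r eps and m + eps, in
    terms of the distances Y = m - y and Z = z - m. *)
Definition slope (s eps : R) : R :=
  ((r eps * eps) `^ s -
   (Z * (Y - r eps * eps) `^ s + Y * (Z + r eps * eps) `^ s) / (Y + Z)) -
  (eps `^ s - (Z * (Y + eps) `^ s + Y * (Z - eps) `^ s) / (Y + Z)).

Definition slope_bound (eps : R) : R := beta + rho * (1 + r eps) *
  ((Z * (Y - r eps * eps) `^ (rho - 1) -
    Y * (Z + r eps * eps) `^ (rho - 1)) / (Y + Z)).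

(** The tangents are taken at Y - r eps and Z + r eps, so that concavity bounds
    both far contributions from above. *)
Lemma slope_le eps : 0 < eps -> eps < Z -> r eps * eps < Y ->
  slope rho eps <= eps * slope_bound eps.
Proof.
move=> e0 eZ reY; have re0 : 0 < r eps * eps by rewrite mulr_gt0 ?ratio_gt0.
rewrite /slope /slope_bound ratio_powR_increment//.
set e := r eps * eps in reY re0 *.
have Ye0 : 0 < Y - e by rewrite subr_gt0.
have Ze0 : 0 < Z - eps by rewrite subr_gt0.
have Ye : 0 < Y + eps by rewrite addr_gt0.
have Ze : 0 < Z + e by rewrite addr_gt0.
have YZ0 : 0 < (Y + Z)^-1 by rewrite invr_gt0 addr_gt0.
have left : (Y + eps) `^ rho <= (Y - e) `^ rho +
    rho * (Y - e) `^ (rho - 1) * (eps + e).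
  have -> : eps + e = Y + eps - (Y - e) by ring.
  by apply: powR_le_tangent.
have right : (Z - eps) `^ rho <= (Z + e) `^ rho -
    rho * (Z + e) `^ (rho - 1) * (eps + e).
  have -> : eps + e = - (Z - eps - (Z + e)) by ring.
  by rewrite mulrN opprK; apply: powR_le_tangent.
have left' := ler_wpM2l (ltW Z_gt0) left.
have right' := ler_wpM2l (ltW Y_gt0) right.
have := ler_wpM2r (ltW YZ0) (lerD left' right').
have eE : eps + e = (1 + r eps) * eps by rewrite mulrDl mul1r.
rewrite eE -subr_ge0 => main; rewrite -subr_ge0; apply: le_trans main _.
by rewrite le_eqVlt; apply/orP; left; apply/eqP; ring.
Qed.

Lemma cvg_ratioM : r eps * eps @[eps --> 0^'+] --> (0 : R).
Proof.
have [r0 [r_cvg _]] := cvg_ratio rho_le1 beta_gt0.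
rewrite -[X in _ --> X](mulr0 r0); apply: cvgM r_cvg _.
exact: cvg_at_right_filter cvg_id.
Qed.

(** The limit of [slope_bound] at 0 is negative by the first bound on beta if
    rho < 1, where r tends to 1, and by the second one if rho = 1, where r is
    1 + beta. *)
Lemma slope_bound_lt0 :
  beta < 2 * rho * (Y / (Y + Z) * Z `^ (rho - 1) -
                    Z / (Y + Z) * Y `^ (rho - 1)) ->
  beta < (Y - Z) / Z ->
  \forall eps \near 0^'+, slope_bound eps < 0.
Proof.
move=> beta1 beta2.
have [r0 [r_cvg r0E]] := cvg_ratio rho_le1 beta_gt0.
have re_cvg := cvg_ratioM.
pose L := beta + rho * (1 + r0) *
  ((Z * Y `^ (rho - 1) - Y * Z `^ (rho - 1)) / (Y + Z)).
have L0 : L < 0.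
  rewrite /L; case: r0E => -[rho1 ->].
    move: beta1; rewrite -subr_lt0; apply: le_lt_trans.
    by rewrite le_eqVlt; apply/orP; left; apply/eqP; ring.
  rewrite rho1 subrr !powRr0 !mulr1 mul1r.
  move: beta2; rewrite ltr_pdivlMr// => beta2.
  rewrite -(@pmulr_llt0 _ (Y + Z)) ?addr_gt0// mulrDl -mulrA divfK; last first.
    by rewrite gt_eqF// addr_gt0.
  lra.
have bound_cvg : slope_bound eps @[eps --> 0^'+] --> L.
  have Y_cvg : Y - r eps * eps @[eps --> 0^'+] --> Y.
    by rewrite -[X in _ --> X]subr0; apply: cvgB re_cvg; exact: cvg_cst.
  have Z_cvg : Z + r eps * eps @[eps --> 0^'+] --> Z.
    by rewrite -[X in _ --> X]addr0; apply: cvgD re_cvg; exact: cvg_cst.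
  apply: cvgD; first exact: cvg_cst.
  apply: cvgM.
    apply: cvgM; first exact: cvg_cst.
    by apply: cvgD r_cvg; exact: cvg_cst.
  apply: cvgM; last exact: cvg_cst.
  by apply: cvgB; (apply: cvgM; [exact: cvg_cst|exact: cvg_powR]).
exact: (cvgr_lt _ bound_cvg).
Qed.

(** With x = beta eps ^ (1 - rho), at most beta, the power on the right is
    (1 + x) ^ (s / rho) eps ^ s, and the tangent at 1 + x, evaluated at 1, bounds
    (1 + x) ^ (s / rho) - 1 below by a multiple of x. *)
Lemma ratio_powR_ge s eps : 0 < s -> s < rho -> 0 < eps -> eps < 1 ->
  eps `^ s +
    s / rho * (1 + beta) `^ (s / rho - 1) * beta * eps `^ (s - rho) * eps
    <= (r eps * eps) `^ s.
Proof.
move=> s0 s_rho e0 e1; rewrite powRM ?(ltW e0) ?(ltW (ratio_gt0 _ _ _))//.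
rewrite powR_ratio; set x := beta * eps `^ (1 - rho).
have e_pow : eps `^ (1 - rho) <= 1.
  rewrite -[leRHS](powRr0 eps); apply: ger_powR; first by rewrite e0 ltW.
  by rewrite subr_ge0.
have x0 : 0 < x by rewrite mulr_gt0// powR_gt0.
have x_beta : x <= beta by rewrite -[leRHS]mulr1 ler_pM2l.
have th0 : 0 < s / rho by rewrite divr_gt0.
have th1 : s / rho <= 1 by rewrite ler_pdivrMr// mul1r ltW.
have x1 : 0 < 1 + x by rewrite addr_gt0.
have := powR_le_tangent th0 th1 ltr01 x1; rewrite powR1 => tangent.
have slope_x : (1 + beta) `^ (s / rho - 1) <= (1 + x) `^ (s / rho - 1).
  by apply: powR_le_anti; rewrite ?lerD2l// subr_le0.
have tx0 : 0 <= s / rho * x * eps `^ s.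
  by rewrite mulr_ge0 ?powR_ge0// mulr_ge0// ltW.
have main := ler_wpM2r (powR_ge0 eps s) tangent.
have := ler_wpM2l tx0 slope_x.
have -> :
    s / rho * (1 + beta) `^ (s / rho - 1) * beta * eps `^ (s - rho) * eps =
    s / rho * x * eps `^ s * (1 + beta) `^ (s / rho - 1).
  rewrite -[s / rho * x * _]mulrA.
  have -> : x * eps `^ s = beta * (eps `^ (s - rho) * eps).
    rewrite -[X in _ = _ * (_ * X)](powRr1 (ltW e0)) /x -mulrA.
    rewrite -!powRD ?(gt_eqF e0) ?implybT//; congr (_ * _ `^ _); ring.
  ring.
move: main; rewrite mul1r; lra.
Qed.

(** The contribution of y is non-negative and is dropped; the one of z is at most
    linear in eps.  As eps tends to 0 the factor eps ^ (s - rho) blows up. *)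
Lemma slope_ge s eps : 0 < s -> s < rho -> 0 < eps -> eps < 1 ->
  eps < Z / 2 -> r eps * eps < Y ->
  eps * (s / rho * (1 + beta) `^ (s / rho - 1) * beta * eps `^ (s - rho) -
         s * (Z / 2) `^ (s - 1) * (1 + (1 + beta) `^ (1 / rho))) <= slope s eps.
Proof.
move=> s0 s_rho e0 e1 eZ reY.
have s1 : s <= 1 by rewrite (le_trans (ltW s_rho)).
have re0 : 0 < r eps * eps by rewrite mulr_gt0 ?ratio_gt0.
have := ratio_powR_ge s0 s_rho e0 e1.
have : r eps * eps <= (1 + beta) `^ (1 / rho) * eps.
  by rewrite ler_pM2r// ratio_le.
rewrite /slope; set e := r eps * eps in reY re0 *.
set R0 := (1 + beta) `^ (1 / rho); set C := s / rho * _ * _ * _.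
move=> eR0 ratio_ge.
have Ye0 : 0 < Y - e by rewrite subr_gt0.
have Ze0 : 0 < Z - eps by lra.
have YZ0 : 0 < (Y + Z)^-1 by rewrite invr_gt0 addr_gt0.
have left : (Y - e) `^ s <= (Y + eps) `^ s.
  by apply: ge0_ler_powR; rewrite ?nnegrE; lra.
have right : (Z + e) `^ s <=
    (Z - eps) `^ s + s * (Z / 2) `^ (s - 1) * ((1 + R0) * eps).
  have Ze : 0 < Z + e by rewrite addr_gt0.
  apply: (le_trans (powR_le_tangent s0 s1 Ze Ze0)); rewrite lerD2l.
  apply: ler_pM; rewrite ?mulr_ge0 ?powR_ge0 ?(ltW s0)//; [lra| |lra].
  rewrite ler_pM2l//; apply: powR_le_anti; lra.
have left' := ler_wpM2l (ltW (mulr_gt0 Z_gt0 YZ0)) left.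
have right' := ler_wpM2l (ltW (mulr_gt0 Y_gt0 YZ0)) right.
have K0 : 0 <= s * (Z / 2) `^ (s - 1) * ((1 + R0) * eps).
  by rewrite !mulr_ge0 ?addr_ge0 ?powR_ge0 ?ltW.
have YYZ1 : Y / (Y + Z) <= 1.
  by rewrite ler_pdivrMr ?addr_gt0// mul1r lerDl ltW.
have := ler_wpM2r K0 YYZ1; rewrite mul1r.
lra.
Qed.

Lemma slope_lt0_gt0 s : 0 < s -> s < rho ->
  beta < 2 * rho * (Y / (Y + Z) * Z `^ (rho - 1) -
                    Z / (Y + Z) * Y `^ (rho - 1)) ->
  beta < (Y - Z) / Z ->
  exists2 eps0, 0 < eps0 & forall eps, 0 < eps -> eps < eps0 ->
    slope rho eps < 0 /\ 0 < slope s eps.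
Proof.
move=> s0 s_rho beta1 beta2.
pose c := s / rho * (1 + beta) `^ (s / rho - 1) * beta.
pose C := s * (Z / 2) `^ (s - 1) * (1 + (1 + beta) `^ (1 / rho)).
have beta1_gt0 : 0 < 1 + beta by rewrite addr_gt0.
have c0 : 0 < c by rewrite 2?mulr_gt0 ?divr_gt0 ?powR_gt0.
have C0 : 0 < C.
  by rewrite mulr_gt0 ?mulr_gt0 ?powR_gt0 ?divr_gt0// addr_gt0 ?powR_gt0.
have [e /= e_gt0 He] : \forall eps \near 0^'+, slope_bound eps < 0 /\
    [/\ eps < 1, eps < Z / 2, r eps * eps < Y & eps `^ (rho - s) < c / C].
  near=> eps; split; last split.
  - by near: eps; exact: slope_bound_lt0.
  - by near: eps; exact: nbhs_right_lt.
  - by near: eps; apply: nbhs_right_lt; rewrite divr_gt0.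
  - by near: eps; exact: (cvgr_lt _ cvg_ratioM).
  - near: eps; have := @powR_cvg0 R (rho - s); rewrite subr_gt0 => /(_ s_rho).
    by move=> /cvgr_lt; apply; rewrite divr_gt0.
exists e => // eps eps0 eps_e.
have [|//|bound [eps1 epsZ repsY pow_lt]] := He eps.
  by rewrite /= sub0r normrN gtr0_norm.
split.
  apply: (le_lt_trans (slope_le eps0 _ repsY)); first by lra.
  by rewrite pmulr_rlt0.
apply: lt_le_trans (slope_ge s0 s_rho eps0 eps1 epsZ repsY).
rewrite pmulr_rgt0// subr_gt0 -/c -/C -opprB powRN ltr_pdivlMr ?powR_gt0//.
by rewrite mulrC -ltr_pdivlMr.
Unshelve. all: by end_near.
Qed.

End slopes.

(** * The perturbed marginal *)

Lemma nu_ymz_discrete (R : realType) (y m z : R) (ym : y < m) (mz : m < z) A :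
  measurable A -> nu_ymz ym mz A = discrete (law y m z m (1 / 3)) A.
Proof.
move=> _; rewrite nu_ymzE !discreteE !diracE -!EFinM -!EFinD; congr EFin.
have zy : z - y != 0 by rewrite subr_eq0 gt_eqF// (lt_trans ym mz).
rewrite !big_cons big_nil /= !indicE /left_weight /right_weight.
by field.
Qed.

Section perturbed_dirac.
Context {R : realType} (rho beta y m z eps : R).
Hypotheses (rho_gt0 : 0 < rho) (rho_le1 : rho <= 1) (beta_gt0 : 0 < beta).
Hypotheses (ym : y < m) (mz : m < z) (eps_gt0 : 0 < eps).
Hypotheses (eps_z : eps < z - m) (eps_1 : eps < 1).
Hypothesis eps_y : eps < (m - y) / (1 + beta) `^ (1 / rho).
Hypothesis eps_yz : eps < 2 * (z - m) * (m - y) / (3 * (z - y)).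
Local Notation r := (Defs.ratio rho beta eps).
Local Notation a := (m - r * eps).
Local Notation b := (m + eps).
Local Notation p := (1 / (1 + r)).
Local Notation q := (r / (1 + r)).

Let r_gt0 : 0 < r. Proof. exact: ratio_gt0. Qed.
Let r1_gt0 : 0 < 1 + r. Proof. by rewrite addr_gt0. Qed.

Let p_gt0 : 0 < p. Proof. by rewrite divr_gt0. Qed.
Let q_gt0 : 0 < q. Proof. by rewrite divr_gt0. Qed.
Let mu : probability R R := mu_eps rho beta m eps.
Let nu : probability R R := nu_ymz ym mz.
Let nu_discrete := @nu_ymz_discrete R y m z ym mz.

Lemma atoms_ordered : [/\ y < a, a < m, m < b & b < z].
Proof.
have re0 : 0 < r * eps by rewrite mulr_gt0.
have reY : r * eps < m - y.
  have K0 : 0 < (1 + beta) `^ (1 / rho) by rewrite powR_gt0// addr_gt0.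
  move: eps_y; rewrite ltr_pdivlMr// => eps_yK.
  apply: le_lt_trans eps_yK; rewrite mulrC ler_pM2l//.
  exact: ratio_le.
by split; [rewrite ltrBrDl -ltrBrDr|rewrite ltrBlDr ltrDl|rewrite ltrDl|
  rewrite -ltrBrDl].
Qed.

Lemma atoms_mean : p * a + q * b = m.
Proof. by field; rewrite gt_eqF. Qed.

Lemma atoms_mass : p + q = 1.
Proof. by field; rewrite gt_eqF. Qed.

(** Here q eps (z - y) / ((z - m) (m - y)) is what the largest conditional masses
    at m lose, on average, by moving the atoms away from m; it must stay below
    1 - 1 / 3, where 1 / 3 is the mass of nu at m. *)
Lemma mass_interval : mass_min m z b p q (1 / 3) < mass_max y m a p (1 / 3).
Proof.
have [ya am mb bz] := atoms_ordered.
apply: mass_min_lt_max => //; rewrite ?divr_gt0//.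
have my : 0 < m - y by rewrite subr_gt0.
have zm : 0 < z - m by rewrite subr_gt0.
have zy : 0 < z - y by rewrite subr_gt0 (lt_trans ym).
have -> : p * ((a - y) / (m - y)) + q * ((z - b) / (z - m)) =
    1 - q * (eps * (z - y) / ((z - m) * (m - y))).
  by field; rewrite !gt_eqF.
have q1 : q <= 1 by rewrite ler_pdivrMr// mul1r lerDr.
have e0 : 0 < eps * (z - y) / ((z - m) * (m - y)).
  by rewrite divr_gt0 ?mulr_gt0.
have e23 : eps * (z - y) / ((z - m) * (m - y)) < 2 / 3.
  rewrite ltr_pdivrMr ?mulr_gt0//.
  by move: eps_yz; rewrite ltr_pdivlMr ?mulr_gt0//; lra.
have := ler_wpM2r (ltW e0) q1; rewrite mul1r; lra.
Qed.

Lemma mu_eps_discrete A : measurable A ->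
  mu_eps rho beta m eps A = discrete [:: (p, a); (q, b)] A.
Proof. by move=> _; rewrite mu_epsE /discrete !big_cons big_nil adde0. Qed.

Lemma slope_middle_gain s :
  middle_gain y m z s a - middle_gain y m z s b =
  slope rho beta (m - y) (z - m) s eps.
Proof.
have [ya am mb bz] := atoms_ordered.
rewrite /middle_gain /slope.
have -> : `|a - m| = r * eps by rewrite ltr0_norm; lra.
have -> : `|a - y| = m - y - r * eps by rewrite gtr0_norm; lra.
have -> : `|a - z| = z - m + r * eps by rewrite ltr0_norm; lra.
have -> : `|b - m| = eps by rewrite gtr0_norm; lra.
have -> : `|b - y| = m - y + eps by rewrite gtr0_norm; lra.
have -> : `|b - z| = z - m - eps by rewrite ltr0_norm; lra.
by have -> : m - y + (z - m) = z - y by ring.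
Qed.

Lemma perturbed_distinct_couplings : exists pi1 pi2,
  [/\ martingale_coupling mu nu pi1, martingale_coupling mu nu pi2 &
      ~ same_measure pi1 pi2].
Proof.
have [ya am mb bz] := atoms_ordered.
exact: (distinct_martingale_couplings ym mz (lt_trans am mb) p_gt0 q_gt0
  atoms_mean atoms_mass mu_eps_discrete nu_discrete ya am mb bz mass_interval).
Qed.

Lemma perturbed_nondecreasing pi :
  martingale_coupling mu nu pi -> nondecreasing_coupling pi.
Proof.
have [ya am mb bz] := atoms_ordered; have ab := lt_trans am mb.
move=> /(martingale_coupling_plan ym mz p_gt0 q_gt0 mu_eps_discrete nu_discrete).
move=> [s _ piE]; apply: nondecreasing_plan piE => //; rewrite ?ltW//.
exact: atoms_mass.
Qed.

Lemma perturbed_optima s1 s2 :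
  0 < slope rho beta (m - y) (z - m) s1 eps ->
  slope rho beta (m - y) (z - m) s2 eps < 0 ->
  exists pi1 pi2, [/\ unique_nondecreasing_attains s1 mu nu pi1,
    unique_nondecreasing_attains s2 mu nu pi2 & ~ same_measure pi1 pi2].
Proof.
have [ya am mb bz] := atoms_ordered.
rewrite -!slope_middle_gain subr_lt0 subr_gt0.
exact: (distinct_optima ym mz (lt_trans am mb) p_gt0 q_gt0
  atoms_mean atoms_mass mu_eps_discrete nu_discrete ya am mb bz mass_interval).
Qed.

End perturbed_dirac.

Theorem proposition2p10 (R : realType) (rho' rho y m z beta : R)
  (rho'_gt0 : 0 < rho') (rho'_lt_rho : rho' < rho) (rho_le1 : rho <= 1)
  (y_lt_mid : y < (y + z) / 2) (mid_lt_m : (y + z) / 2 < m) (m_lt_z : m < z)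
  (beta_gt0 : 0 < beta)
  (beta_lt : beta < Num.min
     (2 * rho * ((m - y) / (z - y) * (z - m) `^ (rho - 1)
                 - (z - m) / (z - y) * (m - y) `^ (rho - 1)))
     ((2 * m - y - z) / (z - m))) :
  let nu : probability R R := nu_ymz (lt_trans y_lt_mid mid_lt_m) m_lt_z in
  let mu (eps : R) : probability R R := mu_eps rho beta m eps in
  (forall eps : R, 0 < eps ->
     eps < Num.min (Num.min (Num.min (z - m)
                                     ((m - y) / (1 + beta) `^ (1 / rho)))
                            (2 * (z - m) * (m - y) / (3 * (z - y))))
                   1 ->
     (exists pi1 pi2, [/\ martingale_coupling (mu eps) nu pi1,
                          martingale_coupling (mu eps) nu pi2 &
                          ~ same_measure pi1 pi2]) /\
     (forall pi, martingale_coupling (mu eps) nu pi ->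
                 nondecreasing_coupling pi))
  /\
  (exists eps0 : R, 0 < eps0 /\
     forall eps : R, 0 < eps -> eps < eps0 ->
       exists pi' pi,
         [/\ unique_nondecreasing_attains rho' (mu eps) nu pi',
             unique_nondecreasing_attains rho (mu eps) nu pi &
             ~ same_measure pi' pi]).
Proof.
move=> nu mu.
have rho_gt0 : 0 < rho by exact: lt_trans rho'_lt_rho.
have ym : y < m by exact: lt_trans y_lt_mid mid_lt_m.
have my : 0 < m - y by rewrite subr_gt0.
have zm : 0 < z - m by rewrite subr_gt0.
have zy : 0 < z - y by rewrite subr_gt0 (lt_trans ym).
split.
  move=> eps eps_gt0; rewrite !lt_min => /andP[/andP[/andP[ez ey] eyz] e1].
  split; first exact: perturbed_distinct_couplings.
  by move=> pi; apply: perturbed_nondecreasing.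
have [||eps0 eps0_gt0 slopes] :=
  @slope_lt0_gt0 R rho beta (m - y) (z - m) rho_gt0 rho_le1 beta_gt0 my zm
    rho' rho'_gt0 rho'_lt_rho.
- move: beta_lt; rewrite lt_min => /andP[+ _].
  by have -> : m - y + (z - m) = z - y by ring.
- move: beta_lt; rewrite lt_min => /andP[_].
  by have -> : m - y - (z - m) = 2 * m - y - z by ring.
exists (Num.min (Num.min (Num.min (Num.min (z - m)
    ((m - y) / (1 + beta) `^ (1 / rho)))
    (2 * (z - m) * (m - y) / (3 * (z - y)))) 1) eps0).
split.
  rewrite !lt_min zm ltr01 eps0_gt0 !andbT !divr_gt0 ?mulr_gt0//.
  by rewrite powR_gt0// addr_gt0.
move=> eps eps_gt0; rewrite !lt_min.
move=> /andP[/andP[/andP[/andP[ez ey] eyz] e1] eps_eps0].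
have [slope_rho slope_rho'] := slopes eps eps_gt0 eps_eps0.
exact: perturbed_optima.
Qed.
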